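(* Let a set of $5$ blue points in the real plane, no three on a line, and a set of $5$ red points, disjoint from the blue points, be given, such that the line through any two blue points contains a red point. Then all $10$ points lie on a (possibly reducible) cubic curve. *)

(* Defs.v *)
From HB Require Import structures.
From mathcomp Require Import all_boot all_order all_algebra.
From mathcomp Require Import finmap.
From mathcomp Require Import mpoly.
From mathcomp Require Import reals.

Set Implicit Arguments.
Unset Strict Implicit.
Unset Printing Implicit Defensive.

Import GRing.Theory.
Local Open Scope ring_scope.

(* The real plane is 'rV[R]_2, with coordinates P 0 0 and P 0 1. *)

Record line (R : realType) := Line {
  line_a : R;
  line_b : R;
  line_c : R;
  line_nondeg : (line_a, line_b) != (0, 0) }.

Definition on_line (R : realType) (l : line R) (P : 'rV[R]_2) : bool :=
  line_a l * P 0 0 + line_b l * P 0 1 + line_c l == 0.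

Definition no_three_on_a_line (R : realType) (B : {fset 'rV[R]_2}) : Prop :=
  forall P Q S : 'rV[R]_2, P \in B -> Q \in B -> S \in B ->
  P != Q -> P != S -> Q != S ->
  ~ exists l : line R, [/\ on_line l P, on_line l Q & on_line l S].

(* The line through two distinct points is the only l satisfying both
   incidence hypotheses. *)
Definition pierces_lines_of (R : realType) (X B : {fset 'rV[R]_2}) : Prop :=
  forall P Q : 'rV[R]_2, P \in B -> Q \in B -> P != Q ->
  forall l : line R, on_line l P -> on_line l Q ->
  exists2 S, S \in X & on_line l S.

(* msize is the total degree plus one, so f has degree exactly 3; f may be
   reducible or have repeated factors. *)
Definition on_cubic_curve (R : realType) (X : {fset 'rV[R]_2}) : Prop :=
  exists2 f : {mpoly R[2]}, msize f = 4%N &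
  forall P : 'rV[R]_2, P \in X -> f.@[fun i => P 0 i] = 0.

(* Main.v *)
Require Import Defs.
From HB Require Import structures.
From mathcomp Require Import all_boot all_order all_algebra.
From mathcomp Require Import finmap.
From mathcomp Require Import mpoly.
From mathcomp Require Import reals.
From mathcomp Require Import ring zify.

(** Assigning to two blue points a red point on the line through them is a proper
edge coloring of K5 with five colors, because two blue lines with a common blue
point share no red point. Such a coloring is unique up to symmetry: the blue
points can be labelled b0, ..., b4 and the red ones r0, ..., r4, with indices
modulo 5, so that r(i + j) lies on the line bi bj.

Write lij for the line bi bj and m for the line b3 r1. Every cubic of the pencil
spanned by l24 l03 l13 and l12 l04 m passes through all the points except
possibly r0 and r2. For a point X on the line PQ, the Grassmann-Pluecker relation
gives [P A X] / [P B X] = [P A Q] / [P B Q]; applied at r0 to pairs of the six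
lines that meet in b1, b3 or b4, it determines the member of the pencil through
r0. The reflection i |-> 1 - i exchanges r0 and r2 and preserves the generators
of the pencil, so it determines likewise the member through r2, and the two
agree because r1 is on both l01 and l24. *)

Set Implicit Arguments.
Unset Strict Implicit.
Unset Printing Implicit Defensive.

Import GRing.Theory.
Local Open Scope ring_scope.

Lemma ord5_ind (P : 'I_5 -> Prop) : P 0 -> P 1 -> P 2 -> P 3 -> P 4 -> forall i, P i.
Proof.
move=> P0 P1 P2 P3 P4 i.
have: i \in [:: 0; 1; 2; 3; 4] by case: i => -[|[|[|[|[|]]]]].
by rewrite !inE => /or4P[|||/orP[]] /eqP ->.
Qed.

Lemma fixfree_involution_even (T : finType) (f : T -> T) :
  involutive f -> (forall x, f x != x) -> ~~ odd #|T|.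
Proof.
move=> fK f_neq; have f_inj := inv_inj fK.
have order2 x : order f x = 2%N.
  apply: (order_cycle (p := [:: x; f x])); rewrite ?mem_head //= ?fK ?eqxx //.
  by rewrite inE eq_sym f_neq.
rewrite -(fcard_order_set f_inj (n := 2)) ?muln2 ?odd_double //.
by apply/subsetP => x _; rewrite inE order2.
Qed.

Section ProperColoring.
Variables (V C : finType) (c : V -> V -> C).
Hypothesis c_sym : forall u v, c u v = c v u.
Hypothesis c_proper : forall u, {in predC1 u &, injective (c u)}.

Definition misses u k := [forall v in predC1 u, c u v != k].

(* The edges of color [k] form a matching, which cannot cover an odd number of
   vertices. *)
Lemma odd_exists_misses k : odd #|V| -> exists u, misses u k.
Proof.
move=> oddV; apply/existsP; apply: contraTT oddV; rewrite negb_exists => /forallP seen.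
pose partner u := odflt u [pick v in predC1 u | c u v == k].
have partnerP u : partner u != u /\ c u (partner u) = k.
  rewrite /partner; case: pickP => [v /andP[vu /eqP]|none] //=.
  have := seen u; rewrite negb_forall_in => /exists_inP[v vu]; rewrite negbK => cuv.
  by have := none v; rewrite vu cuv.
apply: (@fixfree_involution_even _ partner) => u; last by case: (partnerP u).
have [pu cpu] := partnerP u; have [ppu cppu] := partnerP (partner u).
by apply: (@c_proper (partner u)); rewrite ?inE 1?[u == _]eq_sym ?cppu // c_sym cpu.
Qed.

Lemma missed_color_uniq u k l : #|V| = #|C| -> misses u k -> misses u l -> k = l.
Proof.
move=> VC /forall_inP uk /forall_inP ul; apply/eqP; apply: contraT => kl.
have seen : c u @: predC1 u \subset ~: [set k; l].
  by apply/subsetP => _ /imsetP[v vu ->]; rewrite !inE negb_or uk ?ul.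
have := subset_leq_card seen; rewrite card_in_imset ?cardC1; last exact: c_proper.
by have := cardsC [set k; l]; rewrite cards2 kl VC; lia.
Qed.

Lemma missing_vertex_uniq u v k :
  #|V| = #|C| -> odd #|V| -> misses u k -> misses v k -> u = v.
Proof.
move=> VC oddV uk vk.
pose s l := xchoose (odd_exists_misses l oddV).
have sP l : misses (s l) l := xchooseP (odd_exists_misses l oddV).
have s_inj : injective s.
  by move=> l1 l2 s12; apply: (missed_color_uniq (u := s l1)) => //; rewrite s12.
have [s' _ s'K] := inj_card_bij s_inj (eq_leq VC).
have only_s w : misses w k -> w = s k.
  move=> wk; have w_s'w : misses w (s' w) by rewrite -{1}[w]s'K.
  by rewrite -(missed_color_uniq VC w_s'w wk) s'K.
by rewrite (only_s u uk) (only_s v vk).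
Qed.

Lemma same_color_disjoint p q u w : p != q -> w != u -> u \notin [:: p; q] ->
  c u w = c p q -> w \notin [:: p; q].
Proof.
rewrite !inE !negb_or => pq wu /andP[up uq] cuw; apply/andP; split.
- apply: contraNneq uq => wp; apply/eqP/(@c_proper p); rewrite ?inE // 1?eq_sym //.
  by rewrite -cuw wp c_sym.
- apply: contraNneq up => wq; apply/eqP/(@c_proper q); rewrite ?inE //.
  by rewrite [RHS]c_sym -cuw wq c_sym.
Qed.

Lemma color_recurs p q r s : #|V| = #|C| -> odd #|V| -> uniq [:: p; q; r; s] ->
  exists2 w, w \notin [:: p; q] &
    (w != r) && (c r w == c p q) || (w != s) && (c s w == c p q).
Proof.
move=> VC oddV; rewrite (cat_uniq [:: p; q] [:: r; s]).
move=> /and3P[/andP[+ _] /hasPn not_pq /andP[+ _]]; rewrite !mem_seq1 => pq rs.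
have [u u_rs] : exists2 u, u \in [:: r; s] & ~~ misses u (c p q).
  have [cr|] := boolP (misses r (c p q)); last by exists r; rewrite ?mem_head.
  exists s; first by rewrite !inE eqxx orbT.
  by apply: contra rs => cs; apply/eqP/(missing_vertex_uniq VC oddV cr cs).
rewrite negb_forall_in => /exists_inP[w wu /negPn/eqP cuw].
exists w; first exact: same_color_disjoint pq wu (not_pq u u_rs) cuw.
by move: u_rs wu cuw; rewrite !inE => /orP[] /eqP -> -> ->; rewrite eqxx ?orbT.
Qed.

Lemma adjacent_color_neq (I : eqType) (x : I -> V) (x_inj : injective x) i j k :
  uniq [:: i; j; k] -> c (x i) (x j) != c (x i) (x k).
Proof.
move=> /and3P[]; rewrite !inE negb_or => /andP[ij ik] jk _.
by apply: contraNneq jk => /c_proper jk; rewrite -(inj_eq x_inj); apply/eqP/jk;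
  rewrite !inE inj_eq // eq_sym.
Qed.

Section FiveVertices.
Hypotheses (V5 : #|V| = 5%N) (C5 : #|C| = 5%N).

Lemma disjoint_edge_same_color p q r s t : uniq [:: p; q; r; s; t] ->
  c p q \in [:: c r s; c r t; c s t].
Proof.
move=> pqrst; have VC : #|V| = #|C| by rewrite V5.
have oddV : odd #|V| by rewrite V5.
have all5 v : v \in [:: p; q; r; s; t].
  have [||_ ->] := @uniq_min_size _ _ (enum V) pqrst; rewrite -?cardT ?V5 ?mem_enum //.
  by move=> u; rewrite mem_enum.
have [w w_pq] := color_recurs VC oddV (take_uniq 4 pqrst).
have := all5 w; rewrite -(cat1s p) -(cat1s q) catA mem_cat (negPf w_pq) orFb !inE.
by move=> /or3P[] /eqP -> /orP[] /andP[]; rewrite ?eqxx // => _ /eqP <-;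
  rewrite ?[c s r]c_sym eqxx ?orbT.
Qed.

Lemma remaining_edge_same_color (I : eqType) (x : I -> V) (x_inj : injective x) i j k l m :
  uniq [:: i; j; k; l; m] ->
  c (x i) (x j) != c (x k) (x l) -> c (x i) (x j) != c (x k) (x m) ->
  c (x i) (x j) = c (x l) (x m).
Proof.
rewrite -(map_inj_uniq x_inj) => /disjoint_edge_same_color.
by rewrite !inE => /or3P[] /eqP -> //; rewrite eqxx.
Qed.

Lemma exists_parallel_edges : exists2 x : 'I_5 -> V,
  injective x & c (x 0) (x 4) = c (x 1) (x 3).
Proof.
pose x i := enum_val (cast_ord (esym V5) i).
have x_inj : injective x by move=> i j /enum_val_inj /cast_ord_inj.
have relabel_inj (s : 5.-tuple 'I_5) : uniq s -> injective (x \o tnth s).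
  by move=> /tuple_uniqP s_inj; apply: inj_comp.
have := @disjoint_edge_same_color (x 0) (x 4) (x 1) (x 2) (x 3).
rewrite -[[:: x 0; _; _; _; _]]/(map x [:: 0; 4; 1; 2; 3]) map_inj_uniq // => /(_ isT).
rewrite !inE => /or3P[] /eqP c04.
- by exists (x \o tnth [tuple 0; 1; 3; 2; 4]); first exact: relabel_inj.
- by exists x.
- by exists (x \o tnth [tuple 0; 2; 1; 3; 4]); first exact: relabel_inj.
Qed.

Lemma exists_zigzag_path : exists x : 'I_5 -> V,
  [/\ injective x, c (x 0) (x 4) = c (x 1) (x 3) & c (x 1) (x 4) = c (x 2) (x 3)].
Proof.
have [x x_inj c04] := exists_parallel_edges.
have adj := adjacent_color_neq x_inj; have rem := remaining_edge_same_color x_inj.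
have [c14|c14_02] := eqVneq (c (x 1) (x 4)) (c (x 0) (x 2)).
  (* Read the path 0, 4, 1, 3 backwards. *)
  exists (x \o tnth [tuple 3; 4; 2; 0; 1]); split=> [||/=].
  - by apply: inj_comp => //; apply/tuple_uniqP.
  - by rewrite /= [LHS]c_sym [RHS]c_sym.
  - by rewrite /= [LHS]c_sym [RHS]c_sym.
have [c14|c14_03] := eqVneq (c (x 1) (x 4)) (c (x 0) (x 3)); last first.
  by exists x; split=> //; apply: (rem _ _ 0).
have c20 : c (x 2) (x 0) = c (x 3) (x 4).
  apply: (rem _ _ 1) => //; first by rewrite -c04 c_sym adj.
  by rewrite c14 c_sym adj.
have c21 : c (x 2) (x 1) = c (x 3) (x 4).
  apply: (rem _ _ 0) => //; first by rewrite -c14 c_sym adj.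
  by rewrite c04 c_sym adj.
by have := adj 2 0 1 isT; rewrite c20 c21 eqxx.
Qed.

Lemma proper_coloring_K5 : exists (x : 'I_5 -> V) (y : 'I_5 -> C),
  [/\ bijective x, bijective y & forall i j, i != j -> c (x i) (x j) = y (i + j)].
Proof.
have [x [x_inj c04 c14]] := exists_zigzag_path.
have adj := adjacent_color_neq x_inj; have rem := remaining_edge_same_color x_inj.
have c02 : c (x 0) (x 2) = c (x 3) (x 4).
  apply: (rem _ _ 1) => //; first by rewrite -c04 adj.
  by rewrite c14 c_sym adj.
have c01 : c (x 0) (x 1) = c (x 2) (x 4).
  apply: (rem _ _ 3) => //; first by rewrite [c (x 3) _]c_sym -c14 c_sym adj.
  by rewrite -c02 adj.
have c03 : c (x 0) (x 3) = c (x 1) (x 2).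
  apply: (rem _ _ 4) => //; last by rewrite [c (x 4) _]c_sym -c01 adj.
  by rewrite [c (x 4) _]c_sym c14 c_sym [c (x 2) _]c_sym adj.
exists x, (tnth [tuple c (x 1) (x 4); c (x 0) (x 1); c (x 0) (x 2);
                       c (x 0) (x 3); c (x 0) (x 4)]); split.
- by apply: inj_card_bij x_inj _; rewrite V5 card_ord.
- apply: inj_card_bij; last by rewrite C5 card_ord.
  apply/tuple_uniqP; rewrite /= !inE !negb_or !adj // !andbT; apply/and4P; split.
  + by rewrite [c (x 0) _]c_sym adj.
  + by rewrite c14 [c (x 0) _]c_sym adj.
  + by rewrite c14 c_sym [c (x 0) _]c_sym adj.
  + by rewrite c_sym [c (x 0) _]c_sym adj.
- by elim/ord5_ind; elim/ord5_ind => // _; rewrite c_sym.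
Qed.

End FiveVertices.
End ProperColoring.

Section Bracket.
Variable R : comNzRingType.
Implicit Types A B C D P Q X : 'rV[R]_2.

Definition bracket A B C : R :=
  (B 0 0 - A 0 0) * (C 0 1 - A 0 1) - (B 0 1 - A 0 1) * (C 0 0 - A 0 0).

Lemma bracketC12 A B C : bracket A B C = - bracket B A C.
Proof. by rewrite /bracket; ring. Qed.

Lemma bracketC23 A B C : bracket A B C = - bracket A C B.
Proof. by rewrite /bracket; ring. Qed.

Lemma bracket_cycle A B C : bracket A B C = bracket B C A.
Proof. by rewrite /bracket; ring. Qed.

Lemma bracket13 A B : bracket A B A = 0.
Proof. by rewrite /bracket; ring. Qed.

Lemma bracket23 A B : bracket A B B = 0.
Proof. by rewrite /bracket; ring. Qed.

Lemma bracket_plucker A B C D P Q :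
  bracket A B C * bracket P Q D =
  bracket B C D * bracket P Q A - bracket A C D * bracket P Q B
    + bracket A B D * bracket P Q C.
Proof. by rewrite /bracket; ring. Qed.

Lemma bracket_concurrent P Q X A B : bracket P Q X = 0 ->
  bracket P A X * bracket P B Q = bracket P B X * bracket P A Q.
Proof.
move=> PQX; rewrite bracket_plucker (bracketC23 P X Q) PQX bracket13.
by rewrite oppr0 mulr0 mul0r subr0 add0r mulrC.
Qed.

End Bracket.

Section Collinearity.
Variable R : idomainType.
Implicit Types A B P Q S T : 'rV[R]_2.

Lemma row2_eqE A B : (A == B) = (A 0 0 == B 0 0) && (A 0 1 == B 0 1).
Proof.
apply/eqP/andP => [->//|[/eqP AB0 /eqP AB1]]; apply/rowP => -[[|[|i]] lti] //.
- by rewrite (_ : Ordinal lti = 0) //; apply: val_inj.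
- by rewrite (_ : Ordinal lti = 1) //; apply: val_inj.
Qed.

Lemma exists_noncollinear P S : P != S -> exists A, bracket P A S != 0.
Proof.
rewrite row2_eqE negb_and => /orP[PS0|PS1].
- exists (P + delta_mx 0 1); rewrite /bracket !mxE /=.
  by rewrite (_ : _ - _ = P 0 0 - S 0 0) ?subr_eq0 //; ring.
- exists (P + delta_mx 0 0); rewrite /bracket !mxE /=.
  by rewrite (_ : _ - _ = S 0 1 - P 0 1) ?subr_eq0 1?eq_sym //; ring.
Qed.

Lemma bracket_eq0_trans P Q S T :
  P != S -> bracket P Q S = 0 -> bracket P T S = 0 -> bracket P Q T = 0.
Proof.
move=> /exists_noncollinear[A PAS] PQS PTS; apply: (mulIf PAS).
by rewrite bracket_plucker PQS PTS bracket13 mulr0 !mul0r subr0 addr0.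
Qed.

End Collinearity.

Section LineRestriction.
Variables (R : comNzRingType) (n : nat).
Implicit Types P Q : 'rV[R]_n.

Definition line_restriction P Q : {mpoly R[n]} -> {poly R} :=
  mmap polyC (fun i => (P 0 i)%:P + (Q 0 i - P 0 i) *: 'X).
HB.instance Definition _ P Q := GRing.RMorphism.on (line_restriction P Q).

Lemma line_restrictionZ P Q a f :
  line_restriction P Q (a *: f) = a *: line_restriction P Q f.
Proof. by rewrite [LHS]mmapZ mul_polyC. Qed.

Lemma horner_line_restriction P Q f t :
  (line_restriction P Q f).[t] = f.@[fun i => (P + t *: (Q - P)) 0 i].
Proof.
rewrite mevalE /line_restriction /mmap -horner_evalE raddf_sum.
apply: eq_bigr => m _ /=; rewrite horner_evalE hornerM hornerC horner_prod.
by congr (_ * _); apply: eq_bigr => i _; rewrite !hornerE !mxE mulrC.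
Qed.

End LineRestriction.

Lemma msizeM_leqS (R : idomainType) n d e (p q : {mpoly R[n]}) :
  (msize p <= d.+1)%N -> (msize q <= e.+1)%N -> (msize (p * q) <= (d + e).+1)%N.
Proof.
have [->|p_neq0] := eqVneq p 0; first by rewrite mul0r msize0.
have [->|q_neq0] := eqVneq q 0; first by rewrite mulr0 msize0.
by rewrite msizeM //; lia.
Qed.

Section LinePolynomial.
Variable R : comNzRingType.
Implicit Types A B P Q X : 'rV[R]_2.

Definition line_mpoly A B : {mpoly R[2]} :=
  (B 0 0 - A 0 0) *: ('X_1 - (A 0 1)%:MP) - (B 0 1 - A 0 1) *: ('X_0 - (A 0 0)%:MP).

Lemma meval_line_mpoly A B X : (line_mpoly A B).@[fun i => X 0 i] = bracket A B X.
Proof. by rewrite mevalB !mevalZ !mevalB !mevalXU !mevalC. Qed.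

Lemma msize_line_mpoly A B : (msize (line_mpoly A B) <= 2)%N.
Proof.
have msize_coord (i : 'I_2) a : (msize ('X_i - a%:MP : {mpoly R[2]}) <= 2)%N.
  apply: leq_trans (mmeasureD_le _ _ _) _; rewrite mmeasureN.
  by rewrite geq_max msizeX mdeg1 msizeC; case: (_ != _).
apply: leq_trans (mmeasureD_le _ _ _) _; rewrite mmeasureN geq_max.
by rewrite !(leq_trans (msizeZ_le _ _) (msize_coord _ _)).
Qed.

Lemma line_restriction_line_mpoly P Q : line_restriction P Q (line_mpoly P Q) = 0.
Proof.
rewrite /line_restriction !(mmapB, mmapZ, mmapX, mmap1U, mmapC) -!mul_polyC.
by rewrite /=; ring.
Qed.

Lemma line_restriction_neq0 P Q A B :
  (bracket A B P != 0) || (bracket A B Q != 0) ->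
  line_restriction P Q (line_mpoly A B) != 0.
Proof.
apply: contraTneq => restr0.
have vanish t : bracket A B (P + t *: (Q - P)) = 0.
  by rewrite -meval_line_mpoly -horner_line_restriction restr0 horner0.
have := vanish 1; rewrite scale1r subrKC => ->.
by have := vanish 0; rewrite scale0r addr0 => ->; rewrite eqxx.
Qed.

End LinePolynomial.

Lemma pencil_ratio (R : idomainType) (a0 a1 a2 a3 a4 m p : 'rV[R]_2) :
  bracket a1 a2 a4 != 0 -> bracket a1 a4 p = 0 -> bracket a2 a3 p = 0 ->
  bracket a0 a1 a4 * bracket a3 m a2 *
    (bracket a2 a4 p * bracket a0 a3 p * bracket a1 a3 p) =
  bracket a0 a2 a3 * bracket a1 a3 a4 *
    (bracket a1 a2 p * bracket a0 a4 p * bracket a3 m p).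
Proof.
move=> a124 a14p a23p.
have at1 : bracket a1 a3 p * bracket a1 a2 a4 = bracket a1 a2 p * bracket a1 a3 a4.
  exact: bracket_concurrent.
have at3 : bracket a3 a0 p * bracket a3 m a2 = bracket a3 m p * bracket a3 a0 a2.
  by apply: bracket_concurrent; rewrite bracketC12 a23p oppr0.
have at4 : bracket a4 a2 p * bracket a4 a0 a1 = bracket a4 a0 p * bracket a4 a2 a1.
  by apply: bracket_concurrent; rewrite bracketC12 a14p oppr0.
apply: (mulIf a124).
transitivity (bracket a1 a3 p * bracket a1 a2 a4 * (bracket a3 a0 p * bracket a3 m a2)
  * (bracket a4 a2 p * bracket a4 a0 a1)); first by rewrite /bracket; ring.
by rewrite at1 at3 at4 /bracket; ring.
Qed.

Section PentagonCubic.
Variables (R : idomainType) (b r : 'I_5 -> 'rV[R]_2).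
Hypothesis b_generic : forall i j k, uniq [:: i; j; k] -> bracket (b i) (b j) (b k) != 0.
Hypothesis r_on_side : forall i j, i != j -> bracket (b i) (b j) (r (i + j)) = 0.

Let side i j : {mpoly R[2]} := line_mpoly (b i) (b j).

Definition pentagon_cubic : {mpoly R[2]} :=
  (bracket (b 0) (b 1) (b 4) * bracket (b 3) (r 1) (b 2))
    *: (side 2 4 * side 0 3 * side 1 3)
  - (bracket (b 0) (b 2) (b 3) * bracket (b 1) (b 3) (b 4))
    *: (side 1 2 * side 0 4 * line_mpoly (b 3) (r 1)).

Lemma meval_pentagon_cubic (P : 'rV[R]_2) : pentagon_cubic.@[fun i => P 0 i] =
  bracket (b 0) (b 1) (b 4) * bracket (b 3) (r 1) (b 2)
    * (bracket (b 2) (b 4) P * bracket (b 0) (b 3) P * bracket (b 1) (b 3) P)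
  - bracket (b 0) (b 2) (b 3) * bracket (b 1) (b 3) (b 4)
    * (bracket (b 1) (b 2) P * bracket (b 0) (b 4) P * bracket (b 3) (r 1) P).
Proof. by rewrite mevalB !mevalZ !mevalM !meval_line_mpoly. Qed.

Lemma msize_pentagon_cubic : (msize pentagon_cubic <= 4)%N.
Proof.
have msize_lines A B C D P Q :
    (msize (line_mpoly A B * line_mpoly C D * line_mpoly P Q : {mpoly R[2]}) <= 4)%N.
  by apply: (msizeM_leqS (d := 2)); [apply: (msizeM_leqS (d := 1))|]; apply: msize_line_mpoly.
apply: leq_trans (mmeasureD_le _ _ _) _; rewrite mmeasureN geq_max.
by rewrite !(leq_trans (msizeZ_le _ _) (msize_lines _ _ _ _ _ _)).
Qed.

(* The side condition is boolean so that it is decided by computation. *)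
Lemma r_on_line i j k : (i != j) && (i + j == k) -> bracket (b i) (b j) (r k) = 0.
Proof. by case/andP=> ij /eqP <-; apply: r_on_side. Qed.

Lemma pentagon_cubic_root_b i : pentagon_cubic.@[fun j => b i 0 j] = 0.
Proof.
rewrite meval_pentagon_cubic; elim/ord5_ind: i;
  by rewrite !(bracket13, bracket23) !(mulr0, mul0r) subrr.
Qed.

Lemma bracket_exchange_r1 :
  bracket (b 0) (b 1) (b 4) * bracket (b 3) (r 1) (b 2) =
  bracket (b 0) (b 1) (b 2) * bracket (b 3) (r 1) (b 4).
Proof.
rewrite mulrC (bracket_plucker (b 3)) (bracket_cycle (r 1)) !r_on_line //.
by rewrite mul0r mulr0 subr0 add0r mulrC.
Qed.

Lemma pentagon_cubic_root_r k : pentagon_cubic.@[fun j => r k 0 j] = 0.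
Proof.
rewrite meval_pentagon_cubic; apply/eqP; rewrite subr_eq0; apply/eqP.
elim/ord5_ind: k.
- by apply: pencil_ratio; rewrite ?b_generic ?r_on_line.
- by rewrite (r_on_line (i := 2) (j := 4)) // bracket23 !(mulr0, mul0r).
- have reflected := @pencil_ratio _ (b 1) (b 0) (b 4) (b 3) (b 2) (r 1) (r 2).
  rewrite bracket_exchange_r1; apply: etrans (etrans (reflected _ _ _) _);
    first [exact: b_generic | exact: r_on_line | by rewrite /bracket; ring].
- by rewrite (r_on_line (i := 0) (j := 3)) // (r_on_line (i := 1) (j := 2)) // !(mulr0, mul0r).
- by rewrite (r_on_line (i := 1) (j := 3)) // (r_on_line (i := 0) (j := 4)) // !(mulr0, mul0r).
Qed.

Lemma line_restriction_b3_r1_neq0 :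
  line_restriction (b 2) (b 4) (line_mpoly (b 3) (r 1)) != 0.
Proof.
apply: line_restriction_neq0; rewrite -negb_and.
apply/negP => /andP[/eqP b2_on /eqP b4_on].
have [b3r1|b3r1] := eqVneq (b 3) (r 1).
  by have := b_generic (i := 0) (j := 1) (k := 3) isT; rewrite b3r1 r_on_line ?eqxx.
have := b_generic (i := 3) (j := 2) (k := 4) isT.
by rewrite (bracket_eq0_trans b3r1) ?eqxx // bracketC23 ?b2_on ?b4_on oppr0.
Qed.

(* On the line b2 b4 only the second product survives. *)
Lemma pentagon_cubic_neq0 : pentagon_cubic != 0.
Proof.
suff: line_restriction (b 2) (b 4) pentagon_cubic != 0.
  by apply: contraNneq => ->; rewrite raddf0.
rewrite rmorphB /= !line_restrictionZ !rmorphM /= line_restriction_line_mpoly.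
rewrite !mul0r scaler0 sub0r oppr_eq0 scale_poly_eq0 negb_or.
rewrite !mulf_neq0 ?b_generic ?line_restriction_b3_r1_neq0 //.
- by apply: line_restriction_neq0; rewrite orbC b_generic.
- by apply: line_restriction_neq0; rewrite b_generic.
Qed.

End PentagonCubic.

Section RealPlane.
Variable R : realType.
Implicit Types (P Q S : 'rV[R]_2) (B X : {fset 'rV[R]_2}).

Lemma line_through P Q :
  P != Q -> exists l : line R, forall S, on_line l S = (bracket P Q S == 0).
Proof.
move=> PQ; have nondeg : (P 0 1 - Q 0 1, Q 0 0 - P 0 0) != (0, 0).
  by rewrite xpair_eqE !subr_eq0 andbC [Q 0 0 == _]eq_sym -row2_eqE.
exists (Line ((Q 0 1 - P 0 1) * P 0 0 - (Q 0 0 - P 0 0) * P 0 1) nondeg) => S.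
by rewrite /on_line /bracket /=; congr (_ == 0); ring.
Qed.

Lemma no_three_on_a_line_bracket_neq0 B P Q S :
  no_three_on_a_line B -> P \in B -> Q \in B -> S \in B -> uniq [:: P; Q; S] ->
  bracket P Q S != 0.
Proof.
move=> B_gen PB QB SB /and3P[]; rewrite !inE negb_or => /andP[PQ PS] QS _.
apply/eqP => PQS; have [l lE] := line_through PQ.
by apply: (B_gen P Q S) => //; exists l; rewrite !lE bracket13 bracket23 PQS eqxx.
Qed.

Lemma pierces_lines_of_bracket X B P Q :
  pierces_lines_of X B -> P \in B -> Q \in B -> P != Q ->
  exists2 S, S \in X & bracket P Q S = 0.
Proof.
move=> XB PB QB PQ; have [l lE] := line_through PQ.
have [||S SX] := XB P Q PB QB PQ l; rewrite lE ?bracket13 ?bracket23 //.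
by move=> /eqP PQS; exists S.
Qed.

Lemma on_cubic_curve_msize_le X (f : {mpoly R[2]}) :
  f != 0 -> (msize f <= 4)%N ->
  (forall P, P \in X -> f.@[fun i => P 0 i] = 0) -> on_cubic_curve X.
Proof.
move=> f0 f_size fX; pose m : 'X_{1..2} := (U_(0%R) *+ (4 - msize f))%MM.
have msize_m : msize ('X_[m] : {mpoly R[2]}) = (4 - msize f).+1.
  by rewrite msizeX mdegMn mdeg1 mul1n.
exists (f * 'X_[m]) => [|P PX]; last by rewrite mevalM fX // mul0r.
by rewrite msizeM -?(mmeasure_poly_eq0 mdeg 'X_[m]) ?msize_m // addnS /= subnKC.
Qed.

Local Open Scope fset_scope.

Lemma piercing_proper_coloring X B :
  X != fset0 -> no_three_on_a_line B -> [disjoint X & B] -> pierces_lines_of X B ->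
  exists c : B -> B -> X,
    [/\ forall u v, c u v = c v u, forall u, {in predC1 u &, injective (c u)}
      & forall u v, u != v -> bracket (val u) (val v) (val (c u v)) = 0].
Proof.
move=> /fset0Pn[S0 S0X] B_gen XB pierce.
pose c (u v : B) : X :=
  odflt [` S0X] [pick S : X | bracket (val u) (val v) (val S) == 0].
have c_on u v : u != v -> bracket (val u) (val v) (val (c u v)) = 0.
  move=> uv; rewrite /c; case: pickP => [S /eqP //|none] /=.
  have [S SX uvS] := pierces_lines_of_bracket pierce (valP u) (valP v) uv.
  by have := none [` SX]; rewrite /= uvS eqxx.
exists c; split=> // [u v|u v w].
  by congr odflt; apply: eq_pick => S; rewrite bracketC12 oppr_eq0.
rewrite ![_ \in predC1 _]inE ![_ == u]eq_sym => uv uw c_eq; apply/eqP; apply: contraT => vw.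
have u_neq_c : val u != val (c u v).
  apply: contraTneq (fsvalP (c u v)) => <-.
  by apply: (fdisjointP_sym XB); apply: valP.
have := no_three_on_a_line_bracket_neq0 B_gen (valP u) (valP v) (valP w).
rewrite (bracket_eq0_trans u_neq_c) ?c_on //; last by rewrite c_eq c_on.
by rewrite eqxx /= !inE !val_eqE negb_or uv uw vw => /(_ isT).
Qed.

Lemma pentagonal_labelling X B :
  #|` B| = 5%N -> #|` X| = 5%N ->
  no_three_on_a_line B -> [disjoint X & B] -> pierces_lines_of X B ->
  exists b r : 'I_5 -> 'rV[R]_2,
    [/\ injective b, codom b =i B, codom r =i X
      & forall i j, i != j -> bracket (b i) (b j) (r (i + j)%R) = 0].
Proof.
move=> B5 X5 B_gen XB pierce; have X_neq0 : X != fset0 by rewrite -cardfs_gt0 X5.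
have [c [c_sym c_proper c_on]] := piercing_proper_coloring X_neq0 B_gen XB pierce.
rewrite !cardfE in B5 X5.
have [x [y [x_bij y_bij xyE]]] := proper_coloring_K5 c_sym c_proper B5 X5.
have codom_val (A : {fset 'rV[R]_2}) (z : 'I_5 -> A) :
    bijective z -> codom (fun i => val (z i)) =i A.
  move=> [z' _ z'K] P; apply/codomP/idP => [[i ->]|PA]; first exact: valP.
  by exists (z' [` PA]); rewrite z'K.
exists (fun i => val (x i)), (fun k => val (y k)); split; try exact: codom_val.
- by move=> i j /val_inj /(bij_inj x_bij).
- by move=> i j ij; rewrite -xyE // c_on // bij_eq.
Qed.

End RealPlane.

Local Open Scope fset_scope.

Theorem theorem2p13 (R : realType) (blue red : {fset 'rV[R]_2})
  (blue5 : #|` blue| = 5%N) (red5 : #|` red| = 5%N)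
  (blue_gen : no_three_on_a_line blue)
  (red_blue : [disjoint red & blue])
  (red_lines : pierces_lines_of red blue) :
  on_cubic_curve (blue `|` red).
Proof.
have [b [r [b_inj b_blue r_red r_on_side]]] :=
  pentagonal_labelling blue5 red5 blue_gen red_blue red_lines.
have b_generic i j k : uniq [:: i; j; k] -> bracket (b i) (b j) (b k) != 0.
  move=> ijk; apply: (no_three_on_a_line_bracket_neq0 blue_gen); rewrite -?b_blue ?codom_f //.
  by rewrite (map_inj_uniq b_inj [:: i; j; k]).
apply: (on_cubic_curve_msize_le (pentagon_cubic_neq0 b_generic r_on_side)).
  exact: msize_pentagon_cubic.
move=> P; rewrite in_fsetU -b_blue -r_red => /orP[] /codomP[i ->].
- exact: pentagon_cubic_root_b.
- exact: pentagon_cubic_root_r.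
Qed.
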